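(* Let $F$ be a field of characteristic two and let $(A,\sigma)$ be a central simple $F$-algebra of degree $n$ with orthogonal involution, with alternator form $q_\sigma$. Let $t$ be the transpose involution on $M_n(F)$. If $A$ splits, then $(A,\sigma)\simeq(M_n(F),t)$ as algebras with involution if and only if $q_\sigma\simeq\langle1\rangle_q\perp(n^2-n)\times\langle0\rangle_q$.
   Context: $F$ is a field of characteristic two; central simple algebras are finite-dimensional. An involution $\sigma$ on a central simple $F$-algebra $A$ is an anti-automorphism of order two; it is of the first kind if it is the identity on $F$. Put $\mathrm{Alt}(A,\sigma)=\{x-\sigma(x)\mid x\in A\}$. An involution of the first kind is orthogonal if and only if $1\notin\mathrm{Alt}(A,\sigma)$. For $\sigma$ orthogonal, define the alternator subalgebra $S(A,\sigma)=\{x\in A\mid \sigma(x)x\in F\oplus\mathrm{Alt}(A,\sigma)\}$ (it is a unitary $F$-subalgebra of $A$) and, for $x\in S(A,\sigma)$, let $q_\sigma(x)$ be the unique element of $F$ with $\sigma(x)x+q_\sigma(x)\in\mathrm{Alt}(A,\sigma)$; the map $q_\sigma:S(A,\sigma)\to F$ is a totally singular quadratic form (i.e. a quadratic form whose polar form is zero), called the alternator form. For $\alpha_1,\dots,\alpha_m\in F$, $\langle\alpha_1,\dots,\alpha_m\rangle_q$ denotes the totally singular quadratic form $\sum_{i=1}^m\alpha_ix_i^2$ on $F^m$; $k\times q$ denotes the orthogonal sum of $k$ copies of $q$; $\simeq$ between quadratic forms denotes isometry. *)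

(* Defs.v *)
From HB Require Import structures.
From mathcomp Require Import all_boot all_order all_algebra all_field.

Set Implicit Arguments.
Unset Strict Implicit.
Unset Printing Implicit Defensive.

Import GRing.Theory.
Local Open Scope ring_scope.

Section Algebras.
Variable F : fieldType.
Implicit Types A : falgType F.

(* A two-sided ideal of a unital F-algebra is automatically an F-subspace, so
   ranging over {vspace A} covers all ideals; A is nonzero since 1 != 0 in a
   falgType. *)
Definition simple_algebra A : Prop :=
  forall I : {vspace A}, ({:A} * I <= I)%VS -> (I * {:A} <= I)%VS ->
    I = 0%VS \/ I = {:A}%VS.

Definition central_simple A : Prop :=
  'Z({:A})%VS = 1%VS /\ simple_algebra A.

Definition has_degree A (n : nat) : Prop := \dim {:A} = (n ^ 2)%N.

Definition split_algebra A : Prop :=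
  exists (m : nat) (f : {lrmorphism A -> 'M[F]_m}), bijective f.

(* The target is 'M[F]_m with an arbitrary m rather than a generic lalgType,
   because the library gives 'M[F]_m the latter structure only for m = m'.+1. *)
Definition matrix_involution_iso A (m : nat)
    (sigma : A -> A) (tau : 'M[F]_m -> 'M[F]_m) : Prop :=
  exists f : {lrmorphism A -> 'M[F]_m},
    bijective f /\ forall x, f (sigma x) = tau (f x).

End Algebras.

Section QuadraticForms.
Variable F : fieldType.

Definition isometric (V W : lmodType F) (q : V -> F) (r : W -> F) : Prop :=
  exists f : {linear V -> W}, bijective f /\ forall x, r (f x) = q x.

Definition qf_perp (V W : lmodType F) (q : V -> F) (r : W -> F) :
    (V * W)%type -> F :=
  fun x => q x.1 + r x.2.

Definition qf_copies (k : nat) (V : lmodType F) (q : V -> F) :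
    {ffun 'I_k -> V} -> F :=
  fun x => \sum_(i < k) q (x i).

Definition ts_diag (m : nat) (a : 'rV[F]_m) : 'rV[F]_m -> F :=
  fun x => \sum_(i < m) a 0 i * x 0 i ^+ 2.

End QuadraticForms.

(* Only sigma \o sigma = id is required, so the identity of a degree 1 algebra
   is allowed. *)
Record involution1 (F : fieldType) (A : falgType F) := Involution1 {
  inv_fun :> A -> A;
  inv_add : {morph inv_fun : x y / x + y};
  inv_antimul : forall x y, inv_fun (x * y) = inv_fun y * inv_fun x;
  inv_invol : involutive inv_fun;
  inv_scalar : forall c : F, inv_fun c%:A = c%:A
}.

Section Involutions.
Variables (F : fieldType) (A : falgType F) (sigma : involution1 A).

Lemma inv_linear : linear sigma.
Proof.
move=> c x y; rewrite inv_add; congr (_ + _).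
by rewrite -[c *: x]mulr_algl inv_antimul inv_scalar mulr_algr.
Qed.

HB.instance Definition _ := GRing.isLinear.Build F A A *:%R sigma inv_linear.

Definition alt_space : {vspace A} := limg (linfun (fun x => x - sigma x)).

Lemma alt_spaceP (z : A) :
  reflect (exists x, z = x - sigma x) (z \in alt_space).
Proof.
have lin : linear (fun x : A => x - sigma x).
  by move=> c x y /=; rewrite linearP /= opprD addrACA scalerBr.
pose L := GRing.isLinear.Build F A A *:%R _ lin.
pose f : {linear A -> A} := HB.pack (fun x : A => x - sigma x) L.
have fE x : linfun (fun x => x - sigma x) x = x - sigma x by rewrite (lfunE f).
apply: (iffP memv_imgP) => [[x _ ->]|[x ->]]; exists x; rewrite ?fE ?memvf //.
Qed.

(* This characterises orthogonality in characteristic two only. *)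
Definition orthogonal_involution : Prop := 1 \notin alt_space.

(* The characteristic is an argument because it is needed for closure under
   addition, hence for the module structure declared below. *)
Definition alternator_pred (charF2 : 2%N \in [pchar F]) : {pred A} :=
  [pred x | sigma x * x \in (1 + alt_space)%VS].

Variable charF2 : 2%N \in [pchar F].
Local Notation S := (alternator_pred charF2).

Lemma alternator_predP (x : A) :
  reflect (exists c : F, sigma x * x + c%:A \in alt_space) (x \in S).
Proof.
apply: (iffP memv_addP) => [[_ /vlineP[c ->] [v vA eq_v]]|[c cA]].
  by exists (- c); rewrite eq_v scaleNr addrAC subrr add0r.
exists (- c%:A); first by rewrite memvN; apply/vlineP; exists c.
by exists (sigma x * x + c%:A) => //; rewrite addrC addrK.
Qed.

Lemma alternator_subalg_closed : GRing.subsemialg_closed S.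
Proof.
have oppA (x : A) : - x = x by apply: oppr_pchar2; rewrite (pchar_lalg A).
split=> [|||x y /alternator_predP[c cA] /alternator_predP[d dA]].
- apply/alternator_predP; exists 1.
  have sigma1 : sigma 1 = 1 by rewrite -[1]scale1r inv_scalar.
  by rewrite sigma1 mulr1 scale1r -[X in _ + X]oppA subrr mem0v.
- split=> [|x y Sx Sy]; first by rewrite inE mulr0 mem0v.
  rewrite inE /=.
  have -> : sigma (x + y) * (x + y) = (sigma x * x + sigma y * y)
                                    + (sigma x * y + sigma y * x).
    by rewrite raddfD mulrDl !mulrDr (addrC (sigma y * x)) addrACA.
  apply: memvD; first exact: memvD.
  rewrite memvE; apply: subv_trans (addvSr _ _); rewrite -memvE.
  apply/alt_spaceP; exists (sigma x * y).
  by rewrite inv_antimul inv_invol oppA addrC.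
- move=> c x Sx; rewrite inE /= linearZ /= -scalerAl -scalerAr.
  by rewrite !memvZ.
apply/alternator_predP; exists (c * d).
have /alt_spaceP[u eu] := cA.
have -> : sigma (x * y) * (x * y) + (c * d)%:A
        = sigma y * (u - sigma u) * y + c *: (sigma y * y + d%:A).
  rewrite -eu inv_antimul mulrDr mulrDl !mulrA.
  rewrite mulr_algr -scalerAl scalerDr scalerA -[RHS]addrA; congr (_ + _).
  by rewrite addrA -[X in X + _ + _]oppA addNr add0r.
apply: memvD; last exact: memvZ.
apply/alt_spaceP; exists (sigma y * u * y).
by rewrite !inv_antimul inv_invol mulrBr mulrBl !mulrA.
Qed.

HB.instance Definition _ := GRing.isSubalgClosed.Build F A S
  alternator_subalg_closed.

Record alternator_subalgebra := AlternatorSubalgebra {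
  asub_val : A;
  asub_valP : asub_val \in S
}.

HB.instance Definition _ := [isSub for asub_val].
HB.instance Definition _ := [Choice of alternator_subalgebra by <:].
HB.instance Definition _ :=
  [SubChoice_isSubAlgebra of alternator_subalgebra by <:].

Lemma alternator_form_exists (x : alternator_subalgebra) :
  exists c : F, sigma (asub_val x) * asub_val x + c%:A \in alt_space.
Proof. exact/alternator_predP/asub_valP. Qed.

Definition alternator_form (x : alternator_subalgebra) : F :=
  xchoose (alternator_form_exists x).

Lemma alternator_formP (x : alternator_subalgebra) :
  sigma (asub_val x) * asub_val x + (alternator_form x)%:A \in alt_space.
Proof. exact: (xchooseP (alternator_form_exists x)). Qed.

Lemma alternator_form_unique (x : alternator_subalgebra) (c : F) :
  orthogonal_involution ->
  sigma (asub_val x) * asub_val x + c%:A \in alt_space ->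
  alternator_form x = c.
Proof.
move=> orth cA; apply/eqP; rewrite -subr_eq0; apply/negPn/negP => neq0.
case/negP: orth.
rewrite -[1](scalerK neq0); apply: memvZ.
have := memvB (alternator_formP x) cA.
by rewrite opprD addrACA subrr add0r -scalerBl.
Qed.

End Involutions.

(* Main.v *)
(* By Skolem-Noether, A = M_n(F) with sigma(X) = G^-1 X^T G for a symmetric
   matrix G, which is not alternating since sigma is orthogonal. Writing
   Q(v) = v^T G v, an additive map in characteristic two, x lies in S(A, sigma)
   with alternator value c if and only if Q(x e_i) = c Q(e_i) for every i.

   If G = 1, then S(A, sigma) consists of the matrices whose column sums are all
   equal, and the alternator form is the square of the common column sum.

   Conversely, the radical {q_sigma = 0} consists of the matrices whose columns
   all lie in the isotropic subspace V_0 = {Q = 0}, so it has dimension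
   n dim V_0. If this is n^2 - n, then V_0 is a hyperplane and Q is a constant
   times the square of a linear form; rescaling G, all values of Q are squares,
   and the symmetric non-alternating form G has an orthonormal basis. *)
Require Import Defs.
From HB Require Import structures.
From mathcomp Require Import all_boot all_order all_algebra all_field.

Set Implicit Arguments.
Unset Strict Implicit.
Unset Printing Implicit Defensive.

Import GRing.Theory.
Local Open Scope ring_scope.

(** * Linear algebra and involutions on matrix algebras *)

Lemma dim_linear_bijection (F : fieldType) (U V : vectType F)
    (f : {linear U -> V}) :
  injective f -> (forall y, exists x, f x = y) -> \dim {:U} = \dim {:V}.
Proof.
move=> injf surjf.
have ker0 : lker (linfun f) == 0%VS.
  by apply/lker0P => x y; rewrite !lfunE; exact: injf.
have -> : {:V}%VS = limg (linfun f).
  apply/eqP; rewrite eqEsubv subvf andbT; apply/subvP => y _.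
  by have [x <-] := surjf y; rewrite -[f x]lfunE memv_img ?memvf.
by rewrite limg_dim_eq // (eqP ker0) capv0.
Qed.

(** Entry [(0, k)] of the commutation with [delta_mx 0 j] gives [Z j k = Z 0 0] if [k = j] and
    [Z j k = 0] otherwise. *)
Lemma central_mx_scalar (F : fieldType) n (Z : 'M[F]_n) :
  (forall X : 'M_n, X *m Z = Z *m X) -> exists c, Z = c%:M.
Proof.
case: n Z => [|n] Z cZ; first by exists 0; apply/matrixP => [[]].
exists (Z 0 0); apply/matrixP => j k.
have /matrixP/(_ 0 k) := cZ (delta_mx 0 j).
rewrite !mxE (bigD1 j) //= big1 => [|i nij]; last first.
  by rewrite mxE (negPf nij) andbF mul0r.
rewrite (bigD1 0) //= big1 => [|i nij]; last by rewrite mxE (negPf nij) mulr0.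
by rewrite !mxE !eqxx mul1r !addr0 /= mulr_natr eq_sym => ->.
Qed.

(* Skolem-Noether for [X |-> tau X^T]: if [tau E_00] has a nonzero column [b],
   the matrix whose [i]-th column is column [b] of [tau E_0i] intertwines
   [tau] with the transpose. *)
Lemma mx_involution_inner (F : fieldType) n
    (tau : {linear 'M[F]_n.+1 -> 'M[F]_n.+1}) :
  involutive tau -> (forall X Y, tau (X *m Y) = tau Y *m tau X) ->
  exists2 G, G \in unitmx & forall X, tau X = invmx G *m X^T *m G.
Proof.
move=> tauK tauM; have tau_inj := can_inj tauK.
pose E i := delta_mx 0 i : 'M[F]_n.+1.
have tau00 : tau (E 0) != 0.
  rewrite -(linear0 tau) (inj_eq tau_inj); apply/matrix0Pn.
  by exists 0, 0; rewrite mxE !eqxx oner_neq0.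
have [a [b nz_ab]] : exists a b, tau (E 0) a b != 0.
  case/matrix0Pn: tau00 => a [b nz]; by exists a, b.
pose P := \matrix_(a, i) tau (E i) a b.
have tauP X : tau X *m P = P *m X^T.
  apply/matrixP => i l; rewrite !mxE.
  transitivity ((tau X *m tau (E l)) i b).
    by rewrite mxE; apply: eq_bigr => k _; rewrite !mxE.
  rewrite -tauM.
  have -> : E l *m X = \sum_k X l k *: E k.
    apply/matrixP => u v; rewrite summxE !mxE (bigD1 l) //= big1 => [|k nkl].
      rewrite (bigD1 v) //= big1 => [|k nkv].
        by rewrite !mxE !eqxx andbT mulrC.
      by rewrite !mxE [v == k]eq_sym (negPf nkv) andbF mulr0.
    by rewrite mxE (negPf nkl) andbF mul0r.
  rewrite linear_sum summxE; apply: eq_bigr => k _.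
  by rewrite linearZ /= !mxE mulrC.
have uP : P \in unitmx.
  rewrite -row_free_unit; apply: inj_row_free => v vP0.
  apply/eqP; apply: contraNT nz_ab => /rV0Pn[j nz_vj].
  (* In the intertwining relation at [tau E_ja], the right side dies since [v P = 0], while entry 0
     of the left side is [v_j (tau E_00)_ab]. *)
  have := congr1 (mulmx v) (tauP (tau (delta_mx j a))).
  rewrite tauK !mulmxA vP0 mul0mx => /matrixP/(_ 0 0)/eqP.
  rewrite !mxE (bigD1 a) //= big1 => [|k nka]; last first.
    rewrite mxE big1 ?mul0r // => l _.
    by rewrite mxE (negPf nka) andbF mulr0.
  rewrite mxE (bigD1 j) //= big1 => [|l nlj]; last first.
    by rewrite mxE (negPf nlj) mulr0.
  by rewrite !mxE !eqxx mulr1 !addr0 mulf_eq0 (negPf nz_vj).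
exists (invmx P) => [|X]; first by rewrite unitmx_inv.
by rewrite invmxK -tauP mulmxK.
Qed.

(** Since [tau] is an involution, [G^-T G] is central, so [G = c G^T] for a scalar [c]. Transposing
    gives [c^2 = 1], and characteristic two forces [c = 1]. *)
Lemma mx_involution_sym (F : fieldType) (charF2 : 2%N \in [pchar F]) n
    (tau : 'M[F]_n.+1 -> 'M[F]_n.+1) G :
  involutive tau -> G \in unitmx ->
  (forall X, tau X = invmx G *m X^T *m G) -> G^T = G.
Proof.
move=> tauK uG tauE.
have uGt : G^T \in unitmx by rewrite unitmx_tr.
have [c cE] : exists c, invmx G^T *m G = c%:M.
  apply: central_mx_scalar => X.
  have := tauK X; rewrite !tauE !trmx_mul trmxK trmx_inv => eX.
  by rewrite -{2}eX !mulmxA mulmxK // mulVmx // mul1mx.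
have GE : G = c *: G^T by rewrite -mul_mx_scalar -cE mulKVmx.
have GtE : G^T = c *: G by rewrite {1}GE linearZ /= trmxK.
have c2 : (c - 1) ^+ 2 = 0.
  have : c ^+ 2 *: G = 1 *: G by rewrite scale1r {2}GE GtE scalerA.
  move/(congr1 (mulmx^~ (invmx G))); rewrite -!scalemxAl mulmxV //.
  move/matrixP/(_ 0 0); rewrite !mxE !mulr1 => c2.
  by rewrite sqrrB1 c2 (mulr2n c) (addrr_pchar2 charF2) subr0
             (addrr_pchar2 charF2).
by move/eqP: c2; rewrite sqrf_eq0 subr_eq0 => /eqP c1; rewrite GtE c1 scale1r.
Qed.

(** * Symmetric forms in characteristic two and their isotropic vectors *)

Lemma alternating_mxP (F : fieldType) (charF2 : 2%N \in [pchar F]) n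
    (M : 'M[F]_n) : M^T = M -> (forall i, M i i = 0) ->
  exists Z, M = Z - Z^T.
Proof.
move=> symM diagM; exists (\matrix_(i, j) (if (i < j)%N then M i j else 0)).
apply/matrixP => i j; rewrite !mxE; case: ltngtP => [||/val_inj ->].
- by rewrite subr0.
- by rewrite (oppr_pchar2 charF2) add0r -{1}symM mxE.
- by rewrite subrr.
Qed.

(** The two cross terms are 1 x 1 transposes of each other, hence equal, and cancel in
    characteristic two. *)
Lemma qmx_add (F : fieldType) (charF2 : 2%N \in [pchar F]) n (G : 'M[F]_n)
    (v w : 'rV_n) :
  G^T = G -> (v + w) *m G *m (v + w)^T = v *m G *m v^T + w *m G *m w^T.
Proof.
move=> symG; have sw : w *m G *m v^T = v *m G *m w^T.
  by rewrite [LHS]mx11_scalar -tr_scalar_mx -mx11_scalar !trmx_mul trmxK symG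
             mulmxA.
rewrite linearD /= mulmxDr !mulmxDl sw addrACA [X in _ + X]addrC addrA.
rewrite -!addrA; congr (_ + _); rewrite addrCA -[RHS]addr0; congr (_ + _).
by apply/matrixP => i j; rewrite !mxE (addrr_pchar2 charF2).
Qed.

(* Orthonormal rows [U] are extended one at a time, keeping in their orthogonal
   complement a vector [x] of norm 1. If appending [x] leaves an alternating
   complement with a hyperbolic pair [w, y], append [x + w] instead: [x + y] is
   orthogonal to it and has norm 1. *)
Lemma orthonormal_rows (F : fieldType) (charF2 : 2%N \in [pchar F]) n
    (G : 'M[F]_n) :
    G^T = G -> G \in unitmx ->
    (forall v : 'rV_n, exists c : F, v *m G *m v^T = (c ^+ 2)%:M) ->
    (exists v : 'rV_n, v *m G *m v^T != 0) ->
  exists U : 'M_n, U *m G *m U^T = 1%:M.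
Proof.
move=> symG uG sqG [v0 nz_v0].
have normalize (v : 'rV_n) : v *m G *m v^T != 0 ->
    exists2 c, c != 0 & (c *: v) *m G *m (c *: v)^T = 1%:M.
  have [c cE] := sqG v; rewrite cE; have [->|nz_c _] := eqVneq c 0.
    by rewrite expr0n raddf0 eqxx.
  exists c^-1; first by rewrite invr_eq0.
  rewrite linearZ /= -!scalemxAl -scalemxAr cE !scale_scalar_mx.
  by rewrite expr2 mulKf ?mulVf.
have extend k : (k <= n)%N -> exists2 U : 'M_(k, n), U *m G *m U^T = 1%:M &
    k = n \/ exists2 x : 'rV_n, x *m G *m U^T = 0 & x *m G *m x^T = 1%:M.
  elim: k => [|k IHk] lt_kn.
    exists 0; first by apply/matrixP => [[]].
    right; have [c _ c1] := normalize _ nz_v0; exists (c *: v0) => //.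
    by apply/matrixP => i [].
  have [|U orthU [eq_kn|[x orthxU x1]]] := IHk; first exact: ltnW.
    by rewrite eq_kn ltnn in lt_kn.
  have sw p q (v : 'M_(p, n)) (w : 'M_(q, n)) : v *m G *m w^T = (w *m G *m v^T)^T.
    by rewrite !trmx_mul trmxK symG mulmxA.
  have add_row (y : 'rV_n) : y *m G *m U^T = 0 -> y *m G *m y^T = 1%:M ->
      (col_mx y U) *m G *m (col_mx y U)^T = 1%:M.
    move=> orthyU y1; rewrite tr_col_mx mul_col_mx mul_col_row y1 orthU orthyU.
    by rewrite (sw _ _ U) orthyU trmx0 -scalar_mx_block.
  pose C := col_mx x U.
  (* This kernel is the orthogonal complement of the rows of [C]; if it vanishes, [G C^T] has rank
     [n], so [n <= k + 1]. *)
  have [eq_kn|nz_K] := eqVneq (kermx (G *m C^T)) 0.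
    exists C; first exact: add_row.
    left; apply/eqP; rewrite eqn_leq lt_kn /=.
    move/eqP: eq_kn; rewrite kermx_eq0 => /eqP rk; rewrite -{1}rk.
    exact: rank_leq_col.
  have orthC : C *m G *m C^T = 1%:M by exact: add_row.
  have split_orth (y : 'rV_n) : y *m G *m C^T = 0 ->
      y *m G *m x^T = 0 /\ y *m G *m U^T = 0.
    by rewrite /C tr_col_mx mul_mx_row -row_mx0 => /eq_row_mx[].
  have continue (y : 'rV_n) : y *m G *m C^T = 0 -> y *m G *m y^T != 0 ->
      exists2 U : 'M_(k.+1, n), U *m G *m U^T = 1%:M &
        k.+1 = n \/ exists2 x : 'rV_n, x *m G *m U^T = 0 & x *m G *m x^T = 1%:M.
    move=> orthyC /normalize[c _ c1]; exists C => //; right; exists (c *: y) => //.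
    by rewrite -!scalemxAl orthyC scaler0.
  have /rowV0Pn[w /sub_kermxP wC nz_w] := nz_K; rewrite mulmxA in wC.
  have [w0|] := eqVneq (w *m G *m w^T) 0; last exact: continue.
  (* Row [j] of [invmx G] pairs with [w] to the nonzero coordinate [w_j]. *)
  have [z zw1] : exists z : 'rV_n, z *m G *m w^T = 1%:M.
    have /rV0Pn[j nz_wj] := nz_w.
    exists ((w 0 j)^-1 *: (delta_mx 0 j *m invmx G)).
    rewrite -!scalemxAl mulmxKV // -rowE; apply/matrixP => a b.
    by rewrite !ord1 !mxE mulVf.
  (* Gram-Schmidt: removing the component of [z] along [C] leaves the pairing with [w] unchanged, as
     [w] is orthogonal to [C]. *)
  pose y := z - z *m G *m C^T *m C.
  have yC : y *m G *m C^T = 0.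
    by rewrite /y !mulmxBl -!mulmxA [C *m _]mulmxA orthC mulmx1 subrr.
  have yw : y *m G *m w^T = 1%:M.
    by rewrite /y !mulmxBl -!mulmxA [C *m _]mulmxA (sw _ _ C) wC trmx0 !mulmx0 subr0
      mulmxA.
  clearbody y.
  have [y0|] := eqVneq (y *m G *m y^T) 0; last exact: continue.
  have [[wx wU] [yx yU]] := (split_orth _ wC, split_orth _ yC).
  have char2 p q (M : 'M[F]_(p, q)) : M + M = 0.
    by apply/matrixP => a b; rewrite !mxE (addrr_pchar2 charF2).
  exists (col_mx (x + w) U); last right.
    apply: add_row; first by rewrite !mulmxDl orthxU wU addr0.
    by rewrite linearD /= mulmxDr !mulmxDl x1 wx (sw _ _ x) wx trmx0 w0 !addr0.
  exists (x + y).
    have orth_col (v : 'rV_n) : v *m G *m (x + w)^T = 0 -> v *m G *m U^T = 0 ->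
        v *m G *m (col_mx (x + w) U)^T = 0.
      by move=> vx vU; rewrite tr_col_mx mul_mx_row vx vU row_mx0.
    apply: orth_col; last by rewrite !mulmxDl orthxU yU addr0.
    rewrite linearD /= mulmxDr !mulmxDl x1 yx (sw _ _ x) wx trmx0 yw.
    by rewrite addr0 add0r char2.
  by rewrite linearD /= mulmxDr !mulmxDl x1 yx (sw _ _ x) yx trmx0 y0 !addr0.
have [U orthU _] := extend n (leqnn n).
by exists U.
Qed.

(* The matrices with all rows in a subspace of dimension [d] form a space of
   dimension [(n + 1) * d]. *)
Lemma isotropic_rank (F : fieldType) N n (P : pred 'rV[F]_n.+1)
    (L : {linear 'rV[F]_N -> 'M[F]_n.+1}) :
  injective L ->
  (forall X, (exists y, L y = X) <-> (forall i, P (row i X))) ->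
  exists2 D : 'M_(N, n.+1),
    (forall v, P v = (v <= D)%MS) & N = (n.+1 * \rank D)%N.
Proof.
move=> injL imL.
have PL y i : P (row i (L y)) by move: i; apply/imL; exists y.
have P0 : P 0 by have := PL 0 0; rewrite linear0 row0.
(* Completing a vector of [P] by zero rows puts it in the image of [L]. So [P] is the set of top
   rows of that image, which is a row space. *)
pose l0 y := row 0 (L y).
have lin0 : linear l0 by move=> c x y; rewrite /l0 !linearP.
pose l : {linear 'rV_N -> 'rV_n.+1} :=
  HB.pack l0 (GRing.isLinear.Build F _ _ *:%R l0 lin0).
have PD v : P v = (v <= lin1_mx l)%MS.
  apply/idP/submxP => [Pv|[y ->]]; last by rewrite mul_rV_lin1 PL.
  have [|y yE] := (imL (\matrix_i (if i == 0 then v else 0))).2.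
    by move=> i; rewrite rowK; case: ifP.
  by exists y; rewrite mul_rV_lin1 /= /l0 yE rowK eqxx.
exists (lin1_mx l) => //; set D := lin1_mx l in PD *.
(* Coordinates of the rows of [L y] in the basis [B] turn [L] into a bijection onto matrices of size
   [(n + 1) x rank D]. *)
pose B := row_base D.
have LB y : (L y <= B)%MS by rewrite eq_row_base; apply/row_subP => i; rewrite -PD.
have lin1 : linear (fun y => L y *m pinvmx B).
  by move=> c x y; rewrite linearP mulmxDl scalemxAl.
pose f : {linear 'rV_N -> 'M_(n.+1, \rank D)} :=
  HB.pack (fun y => L y *m pinvmx B)
          (GRing.isLinear.Build F _ _ *:%R (fun y => L y *m pinvmx B) lin1).
have := @dim_linear_bijection _ _ _ f; rewrite !dimvf !dim_matrix mul1r.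
apply=> [x y /= /(congr1 (mulmx^~ B))|Z].
  by rewrite !mulmxKpV // => /injL.
have [|y yE] := (imL (Z *m B)).2; last first.
  by exists y; rewrite /= yE mulmxKp // row_base_free.
move=> i; rewrite PD -(eq_row_base D).
by rewrite row_mul submxMl.
Qed.

(** A standard basis vector [e] outside the hyperplane [D] spans a complement. The form is additive
    and vanishes on [D], so only the value at [t e], which is [t^2] times that at [e], survives. *)
Lemma isotropic_hyperplane (F : fieldType) (charF2 : 2%N \in [pchar F]) m n
    (G : 'M[F]_n) (D : 'M_(m, n)) :
  G^T = G -> (\rank D).+1 = n ->
  (forall v : 'rV_n, (v *m G *m v^T == 0) = (v <= D)%MS) ->
  exists2 e : 'rV_n, e *m G *m e^T != 0 &
    forall v : 'rV_n, exists c, v *m G *m v^T = c ^+ 2 *: (e *m G *m e^T).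
Proof.
move=> symG rD isoD.
have [i niD] : exists i, ~~ (row i 1%:M <= D)%MS.
  apply/existsP; rewrite -negb_forall; apply/negP => /forallP sub1.
  have /mxrankS : (1%:M <= D)%MS by apply/row_subP.
  by rewrite mxrank1 => /(leq_trans (eq_leq rD)); rewrite ltnn.
set e := row i 1%:M in niD.
exists e; first by rewrite isoD.
move=> v; have : (v <= D + e)%MS.
  have /rank_ltmx : (D < D + e)%MS by rewrite ltmxE addsmxSl addsmx_sub submx_refl.
  move/(leq_trans (eq_leq (esym rD))) => le_n.
  by rewrite submx_full // /row_full eqn_leq rank_leq_col.
case/sub_addsmxP => -[u t] /= ->.
exists (t 0 0); rewrite qmx_add //.
have /eqP-> : (u *m D) *m G *m (u *m D)^T == 0 by rewrite isoD submxMl.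
have -> : t *m e = t 0 0 *: e by rewrite {1}[t]mx11_scalar mul_scalar_mx.
by rewrite add0r linearZ /= -!scalemxAl -scalemxAr scalerA -expr2.
Qed.

(** * Alternators in terms of the Gram matrix *)

Section AdjointInvolution.
Variables (F : fieldType) (charF2 : 2%N \in [pchar F]) (A : falgType F) (n : nat).
Variables (sigma : involution1 A) (f : {lrmorphism A -> 'M[F]_n}) (G : 'M[F]_n).
Hypotheses (bij_f : bijective f) (symG : G^T = G) (uG : G \in unitmx).
Hypothesis sigmaE : forall x, f (sigma x) = invmx G *m (f x)^T *m G.

(** Left multiplication by [G] turns [y - sigma y] into [G Y - (G Y)^T] with [Y = f y], and so
    carries [alt_space] onto the alternating matrices. *)
Lemma mem_alt_space x :
  (x \in alt_space sigma) <->
  ((G *m f x)^T = G *m f x /\ forall i, (G *m f x) i i = 0).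
Proof.
have [g fK gK] := bij_f.
have GE y : G *m f (y - sigma y) = G *m f y - (G *m f y)^T.
  by rewrite raddfB /= sigmaE mulmxBr -mulmxA mulKVmx // trmx_mul symG.
split=> [/alt_spaceP[y ->]|[symx diagx]].
  rewrite GE; split=> [|i]; last by rewrite !mxE subrr.
  rewrite linearB /= trmxK; apply/matrixP => i j.
  by rewrite !mxE -[LHS](oppr_pchar2 charF2) opprB.
have [Z ZE] := alternating_mxP charF2 symx diagx.
apply/alt_spaceP; exists (g (invmx G *m Z)).
apply: (can_inj fK); apply: (can_inj (mulKmx uG)).
by rewrite GE gK mulKVmx.
Qed.

(** Multiplication by [G] produces [X^T G X + c G] with [X = f x]. This is symmetric, so only its
    diagonal, given by the columns of [X], has to vanish. *)
Lemma alternator_mxP x c :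
  (sigma x * x + c%:A \in alt_space sigma) <->
  (forall i, row i (f x)^T *m G *m (row i (f x)^T)^T = (c * G i i)%:M).
Proof.
have GE : G *m f (sigma x * x + c%:A) = (f x)^T *m G *m f x + c *: G.
  rewrite raddfD /= rmorphM /= linearZ /= rmorph1 sigmaE mulmxDr.
  by rewrite !mulmxA mulmxV // mul1mx -scalemxAr mulmx1.
have diagE i : ((f x)^T *m G *m f x) i i =
    (row i (f x)^T *m G *m (row i (f x)^T)^T) 0 0.
  by rewrite !tr_row trmxK -row_mul !mxE; apply: eq_bigr => k _; rewrite !mxE.
split=> [/mem_alt_space[_ diag0] i|diagG].
  move: diag0; rewrite GE => diag0.
  rewrite [LHS]mx11_scalar -diagE; congr _%:M.
  move/eqP: (diag0 i); rewrite !mxE addr_eq0 (oppr_pchar2 charF2).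
  by move/eqP.
apply/mem_alt_space; rewrite GE; split=> [|i]; last first.
  by rewrite mxE diagE diagG !mxE mulr1n (addrr_pchar2 charF2).
by rewrite linearD /= linearZ /= !trmx_mul trmxK symG mulmxA.
Qed.

End AdjointInvolution.

(** * The alternator form of the transpose *)

Lemma inj_surj_bij (T : choiceType) (U : eqType) (f : T -> U) :
  injective f -> (forall y, exists x, f x = y) -> bijective f.
Proof.
move=> injf surjf.
have surjb y : exists x, f x == y by have [x <-] := surjf y; exists x.
have fK y : f (xchoose (surjb y)) = y by apply/eqP/(xchooseP (surjb y)).
by exists (fun y => xchoose (surjb y)) => // x; apply: injf.
Qed.

(** Supplies the coordinates on the zero summand of the target form. *)
Lemma mx_ffun_iso (F : fieldType) p q N : N = (p * q)%N ->
  exists2 g : {linear 'M[F]_(p, q) -> {ffun 'I_N -> 'rV[F]_1}},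
    injective g & forall z, exists Y, g Y = z.
Proof.
move=> ->; pose g0 (Y : 'M[F]_(p, q)) := [ffun k => (mxvec Y 0 k)%:M : 'rV[F]_1].
have lin : linear g0.
  move=> c X Y; apply/ffunP => k; rewrite !ffunE linearP /= !mxE.
  by rewrite raddfD /= scale_scalar_mx.
exists (HB.pack g0 (GRing.isLinear.Build F _ _ *:%R g0 lin)
        : {linear 'M[F]_(p, q) -> {ffun 'I_(p * q) -> 'rV[F]_1}}) => /=.
  move=> X Y /ffunP eqXY; apply: (can_inj mxvecK); apply/rowP => k.
  by have /matrixP/(_ 0 0) := eqXY k; rewrite !ffunE !mxE eqxx !mulr1n.
move=> z; exists (vec_mx (\row_k z k 0 0)); apply/ffunP => k.
by rewrite ffunE vec_mxK mxE -mx11_scalar.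
Qed.

Local Notation one_perp_zeros F N :=
  (qf_perp (ts_diag (const_mx 1 : 'rV[F]_1))
     (@qf_copies F N 'rV[F]_1 (ts_diag (const_mx 0 : 'rV[F]_1)))).

Lemma one_perp_zerosE (F : fieldType) N w : one_perp_zeros F N w = w.1 0 0 ^+ 2.
Proof.
rewrite /qf_perp /qf_copies /ts_diag big_ord1 mxE mul1r.
rewrite big1 ?addr0 // => i _; rewrite big1 // => j _.
by rewrite mxE mul0r.
Qed.

Section TransposeForm.
Variables (F : fieldType) (charF2 : 2%N \in [pchar F]) (A : falgType F) (n : nat).
Variable sigma : involution1 A.
Local Notation S := (alternator_subalgebra sigma charF2).
Local Notation q := (@alternator_form F A sigma charF2).

Lemma sum_sqr_pchar2 (I : finType) (x : I -> F) :
  \sum_i x i ^+ 2 = (\sum_i x i) ^+ 2.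
Proof.
rewrite -(pFrobenius_autE charF2) rmorph_sum.
by apply: eq_bigr => i _; rewrite /= pFrobenius_autE.
Qed.

(** A matrix with equal column sums is determined by that common sum and by all its rows but the
    first, which are arbitrary. These are [1 + n (n + 1)] free coordinates, and the form is the
    square of the first. *)
Lemma transpose_form (f : {lrmorphism A -> 'M[F]_n.+1}) :
  bijective f -> (forall x, f (sigma x) = (f x)^T) ->
  isometric q (one_perp_zeros F (n.+1 ^ 2 - n.+1)).
Proof.
move=> bij_f fsig.
have sigmaE x : f (sigma x) = invmx 1%:M *m (f x)^T *m 1%:M.
  by rewrite fsig invmx1 mul1mx mulmx1.
have memS x c : sigma x * x + c%:A \in alt_space sigma <->
    forall j, (\sum_i f x i j) ^+ 2 = c.
  have := alternator_mxP charF2 bij_f (trmx1 _ _) (unitmx1 _ _) sigmaE x c.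
  have eq_sum j : row j (f x)^T *m 1%:M *m (row j (f x)^T)^T
      = ((\sum_i f x i j) ^+ 2)%:M.
    rewrite mulmx1 [LHS]mx11_scalar mxE -sum_sqr_pchar2; congr _%:M.
    by apply: eq_bigr => i _; rewrite !mxE expr2.
  move=> [inS Sin]; split=> [/inS eqc j|eqc].
    by have /matrixP/(_ 0 0) := eqc j; rewrite eq_sum !mxE !eqxx !mulr1n mulr1.
  by apply: Sin => j; rewrite eq_sum eqc mxE eqxx mulr1.
(* Membership only equates the squares of the column sums; injectivity of Frobenius equates the
   sums. *)
have sqr_inj : injective (fun c : F => c ^+ 2).
  move=> c d; rewrite -!(pFrobenius_autE charF2); exact: fmorph_inj.
pose X (s : S) : 'M[F]_(1 + n, n.+1) := f (\val s).
pose c (s : S) := \sum_i X s i 0.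
have sumX s j : \sum_i X s i j = c s.
  apply: sqr_inj; have /memS eq_sq := alternator_formP s.
  by rewrite eq_sq -(eq_sq 0).
have qE s : q s = c s ^+ 2.
  by have /memS/(_ 0) := alternator_formP s.
have linX : linear X.
  by move=> a s t; rewrite /X !linearP.
have eN : (n.+1 ^ 2 - n.+1 = n * n.+1)%N by rewrite -mulnn -{3}[n.+1]mul1n -mulnBl subn1.
have [g injg surjg] := mx_ffun_iso F eN.
pose h0 (s : S) := ((c s)%:M : 'rV[F]_1, g (dsubmx (X s))).
have lin : linear h0.
  move=> a s t; rewrite /h0 linX !linearP; congr (_, _).
  rewrite /c linX /= scale_scalar_mx -raddfD /= mulr_sumr -big_split.
  by congr _%:M; apply: eq_bigr => i _; rewrite !mxE.
pose h : {linear S -> ('rV[F]_1 * {ffun 'I_(n.+1 ^ 2 - n.+1) -> 'rV[F]_1})%type} :=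
  HB.pack h0 (GRing.isLinear.Build F _ _ *:%R h0 lin).
exists h; split=> [|s]; last first.
  by rewrite one_perp_zerosE qE /= !mxE eqxx.
have sum_split (M : 'M[F]_(1 + n, n.+1)) j :
    \sum_i M i j = usubmx M 0 j + \sum_i dsubmx M i j.
  rewrite big_split_ord big_ord1 /= !mxE; congr (_ + _).
  by apply: eq_bigr => i _; rewrite mxE.
apply: inj_surj_bij => [s t|[z w]].
  case=> /matrixP/(_ 0 0); rewrite !mxE eqxx !mulr1n => eqc /injg eqd.
  apply: val_inj; apply: (bij_inj bij_f).
  suff equ : usubmx (X s) = usubmx (X t).
    have : X s = X t by rewrite -[X s]vsubmxK equ eqd vsubmxK.
    by [].
  apply/rowP => j; apply: (@addIr _ (\sum_i dsubmx (X t) i j)).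
  by rewrite -sum_split -{1}eqd -sum_split !sumX.
have [Y YE] := surjg w; have [f' fK gK] := bij_f.
(* The first row is chosen to bring every column sum to [z 0 0]. *)
pose M : 'M[F]_(1 + n, n.+1) := col_mx (\row_j (z 0 0 - \sum_i Y i j)) Y.
have sumM j : \sum_i M i j = z 0 0.
  by rewrite sum_split col_mxKu col_mxKd mxE subrK.
have inS : f' M \in alternator_pred sigma charF2.
  by apply/alternator_predP; exists (z 0 0 ^+ 2); apply/memS => j; rewrite gK sumM.
exists (AlternatorSubalgebra inS); rewrite /= /h0 /c /X /= gK.
by rewrite sumM -mx11_scalar col_mxKd YE.
Qed.

End TransposeForm.

(** * Recovering the transpose from the alternator form *)

Section AlternatorFormIsometry.
Variables (F : fieldType) (charF2 : 2%N \in [pchar F]) (A : falgType F) (n : nat).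
Variables (sigma : involution1 A) (orth : orthogonal_involution sigma).
Local Notation S := (alternator_subalgebra sigma charF2).
Local Notation q := (@alternator_form F A sigma charF2).

Lemma adjoint_involution (f : {lrmorphism A -> 'M[F]_n.+1}) :
  bijective f ->
  exists G, [/\ G^T = G, G \in unitmx &
    forall x, f (sigma x) = invmx G *m (f x)^T *m G].
Proof.
move=> [g fK gK].
have ling : linear g := can2_linear fK gK.
have lin : linear (fun X => f (sigma (g X))).
  by move=> a X Y; rewrite ling !linearP.
pose tau : {linear 'M[F]_n.+1 -> 'M[F]_n.+1} :=
  HB.pack (fun X => f (sigma (g X)))
          (GRing.isLinear.Build F _ _ *:%R (fun X => f (sigma (g X))) lin).
have tauK : involutive tau by move=> X; rewrite /= fK inv_invol gK.
have tauM X Y : tau (X *m Y) = tau Y *m tau X.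
  have gM : g (X *m Y) = g X * g Y.
    by apply: (can_inj fK); rewrite rmorphM /= !gK.
  by rewrite /= gM inv_antimul rmorphM.
have [G uG tauE] := mx_involution_inner tauK tauM.
exists G; split=> // [|x]; first exact: mx_involution_sym tauK uG tauE.
by rewrite -tauE /= fK.
Qed.

(** The isometry identifies the zero summand with the zeros of [q], the elements whose columns are
    all isotropic. Counting dimensions gives [(n + 1) n = (n + 1) rank D]. *)
Lemma isotropic_hyperplane_of_isometry (f : {lrmorphism A -> 'M[F]_n.+1}) G :
  bijective f -> G^T = G -> G \in unitmx ->
  (forall x, f (sigma x) = invmx G *m (f x)^T *m G) ->
  isometric q (one_perp_zeros F (n.+1 ^ 2 - n.+1)) ->
  exists2 D : 'M[F]_(n.+1 ^ 2 - n.+1, n.+1), \rank D = n &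
    forall v : 'rV_n.+1, (v *m G *m v^T == 0) = (v <= D)%MS.
Proof.
move=> bij_f symG uG sigmaE [h [[k hK kK] qh]].
have memS := alternator_mxP charF2 bij_f symG uG sigmaE.
have lin_k : linear k := can2_linear hK kK.
pose N := (n.+1 ^ 2 - n.+1)%N.
pose incl (y : 'rV[F]_N) :=
  (0 : 'rV[F]_1, [ffun i : 'I_N => (y 0 i)%:M : 'rV[F]_1]).
have lin_incl : linear incl.
  move=> a y z; congr (_, _); first by rewrite /= scaler0 addr0.
  apply/ffunP => i; rewrite !ffunE !mxE.
  by rewrite raddfD /= scale_scalar_mx.
(* Transposing makes the isotropic columns into rows, as [isotropic_rank] expects. *)
have lin : linear (fun y => (f (\val (k (incl y))))^T).
  by move=> a y z; rewrite lin_incl lin_k !linearP.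
pose L : {linear 'rV[F]_N -> 'M[F]_n.+1} :=
  HB.pack (fun y => (f (\val (k (incl y))))^T)
    (GRing.isLinear.Build F _ _ *:%R (fun y => (f (\val (k (incl y))))^T) lin).
have injL : injective L.
  move=> y z /trmx_inj/(bij_inj bij_f)/val_inj/(can_inj kK)[/ffunP eq_yz].
  apply/rowP => i.
  by have /matrixP/(_ 0 0) := eq_yz i; rewrite !ffunE !mxE eqxx !mulr1n.
have imL X : (exists y, L y = X) <->
    (forall i, row i X *m G *m (row i X)^T == 0).
  split=> [[y <-] i|isoX].
    have /memS/(_ i) -> := alternator_formP (k (incl y)).
    by rewrite -qh kK one_perp_zerosE /= mxE expr0n mul0r raddf0.
  have [f' fK gK] := bij_f.
  have alt0 : sigma (f' X^T) * f' X^T + 0%:A \in alt_space sigma.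
    by apply/memS => i; rewrite gK trmxK mul0r raddf0; apply/eqP.
  have inS : f' X^T \in alternator_pred sigma charF2.
    by apply/alternator_predP; exists 0.
  pose s : S := AlternatorSubalgebra inS.
  (* Orthogonality makes the alternator value unique, so the value 0 exhibited by [alt0] is the
     chosen one. *)
  have q0 : q s = 0 by apply: alternator_form_unique.
  exists (\row_i (h s).2 i 0 0).
  have ks : k (incl (\row_i (h s).2 i 0 0)) = s.
    apply: (canLR hK); rewrite /incl [RHS]surjective_pairing; congr (_, _).
      apply/rowP => i; rewrite ord1 mxE; apply/esym/eqP.
      by rewrite -sqrf_eq0 -(one_perp_zerosE (h s)) qh q0.
    by apply/ffunP => i; rewrite ffunE mxE -mx11_scalar.
  by rewrite /= ks /= gK trmxK.
have [D isoD eqN] :=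
  isotropic_rank (P := fun v => v *m G *m v^T == 0) injL imL.
exists D => //; apply/eqP; rewrite -(eqn_pmul2l (ltn0Sn n)) -eqN.
by rewrite /N -mulnn -{3}[n.+1]muln1 -mulnBr subn1.
Qed.

(** All values of [G] are squares times [a], so [a^-1 G] has an orthonormal basis [U]; conjugating
    [f] by [U^T] turns [sigma] into the transpose. *)
Lemma isometry_transpose (f : {lrmorphism A -> 'M[F]_n.+1}) :
  bijective f ->
  isometric q (one_perp_zeros F (n.+1 ^ 2 - n.+1)) ->
  matrix_involution_iso sigma (fun M : 'M[F]_n.+1 => M^T).
Proof.
move=> bij_f isom.
have [G [symG uG sigmaE]] := adjoint_involution bij_f.
have [D rD isoD] :=
  isotropic_hyperplane_of_isometry bij_f symG uG sigmaE isom.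
have [e nz_e eE] := isotropic_hyperplane charF2 symG (congr1 succn rD) isoD.
set a := (e *m G *m e^T) 0 0.
have eGe : e *m G *m e^T = a%:M by exact: mx11_scalar.
have nz_a : a != 0.
  by apply: contraNneq nz_e => a0; rewrite eGe a0 raddf0.
have [U orthU] : exists U : 'M_n.+1, U *m (a^-1 *: G) *m U^T = 1%:M.
  have uaG : a^-1 *: G \in unitmx by rewrite unitmxZ // unitfE invr_eq0.
  apply: (orthonormal_rows charF2) => // [|v|].
  - by rewrite linearZ /= symG.
  - have [c cE] := eE v; exists c.
    rewrite -scalemxAr -scalemxAl cE eGe !scale_scalar_mx.
    by rewrite mulrCA mulVf // mulr1.
  exists e; rewrite -scalemxAr -scalemxAl eGe scale_scalar_mx mulVf //.
  exact: matrix_nonzero1.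
rewrite -scalemxAr -scalemxAl in orthU.
have uU : U \in unitmx.
  have : U *m (a^-1 *: (G *m U^T)) = 1%:M by rewrite -scalemxAr mulmxA.
  by case/mulmx1_unit.
have uUt : U^T \in unitmx by rewrite unitmx_tr.
have lin : linear (fun x => invmx U^T *m f x *m U^T).
  by move=> b x y; rewrite linearP mulmxDr mulmxDl -scalemxAr -scalemxAl.
have mul : monoid_morphism (fun x => invmx U^T *m f x *m U^T).
  split=> [|x y]; first by rewrite rmorph1 mulmx1 mulVmx.
  by rewrite rmorphM /= -!mulmxE !mulmxA mulmxK.
pose g : {lrmorphism A -> 'M[F]_n.+1} :=
  HB.pack (fun x => invmx U^T *m f x *m U^T)
    (GRing.isLinear.Build F _ _ *:%R _ lin)
    (GRing.isMonoidMorphism.Build _ _ _ mul).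
exists g; split=> [|x /=].
  have [f' fK gK] := bij_f.
  exists (fun X => f' (U^T *m X *m invmx U^T)) => [x|X] /=.
    by rewrite !mulmxA mulmxV // mul1mx mulmxK.
  by rewrite gK !mulmxA mulVmx // mul1mx mulmxKV.
(* The scalars in [G U^T = a U^-1] and [U^-T G^-1 = a^-1 U] cancel, so the image of [sigma x] is
   [U (f x)^T U^-1], the transpose of the image of [x]. *)
have UGU : U *m G *m U^T = a%:M.
  by apply: (scalerI (invr_neq0 nz_a)); rewrite orthU scale_scalar_mx mulVf.
have GU : G *m U^T = a *: invmx U.
  by rewrite -mul_mx_scalar -UGU !mulmxA mulVmx // mul1mx.
have UG : invmx U^T *m invmx G = a^-1 *: U.
  apply: (can_inj (mulmxK uG)); rewrite mulmxKV //.
  apply: (can_inj (mulmxK uUt)); rewrite mulVmx //.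
  by rewrite -!scalemxAl UGU scale_scalar_mx mulVf.
rewrite sigmaE !trmx_mul trmxK trmx_inv trmxK !mulmxA UG -mulmxA GU.
by rewrite -!scalemxAl -scalemxAr scalerA mulVf // scale1r.
Qed.

End AlternatorFormIsometry.

Theorem theorem3p14 (F : fieldType) (charF2 : 2%N \in [pchar F])
    (A : falgType F) (n : nat) (sigma : involution1 A)
    (csA : central_simple A) (degA : has_degree A n)
    (orth_sigma : orthogonal_involution sigma) (splitA : split_algebra A) :
  matrix_involution_iso sigma (fun M : 'M[F]_n => M^T) <->
  isometric (@alternator_form F A sigma charF2)
    (qf_perp (ts_diag (const_mx 1 : 'rV[F]_1))
       (@qf_copies F (n ^ 2 - n) 'rV[F]_1
          (ts_diag (const_mx 0 : 'rV[F]_1)))).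
Proof.
have [m [f bij_f]] := splitA.
have eq_mn : m = n.
  have surj y : exists x, f x = y by have [g _ gK] := bij_f; exists (g y).
  have := dim_linear_bijection (bij_inj bij_f) surj.
  rewrite degA dimvf dim_matrix => /esym/eqP.
  by rewrite [(m * m)%R]mulnn eqn_exp2r // => /eqP.
subst m; case: n degA f bij_f => [|n] degA f bij_f.
  (* Degree 0 is impossible: all 0 x 0 matrices are equal, whereas [1 != 0] in [A]. *)
  have /eqP := oner_neq0 A; case; apply: (bij_inj bij_f).
  by apply/matrixP => [[]].
split=> [[g [bij_g gsig]]|]; first exact: transpose_form bij_g gsig.
exact: isometry_transpose bij_f.
Qed.
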